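(* Let $\gamma\in(0,1]$. Then the function $v:(0,\infty)\to\mathbb{R}$ given by $$v(t)=\frac{t}{(t^{\gamma}+1)^{1/\gamma}}$$ is a bounded and standard Bernstein function.
   Context: A smooth function $v:(0,\infty)\to\mathbb{R}$ is called a Bernstein function if $v(t)\ge 0$ and $(-1)^{k+1}\frac{d^k v}{dt^k}(t)\ge 0$ for all $k\in\mathbb{N}=\{1,2,\ldots\}$ and $t>0$. Write $v(0+):=\lim_{t\to0+}v(t)$ and $\nabla v(0+):=\lim_{t\to 0+}\frac{dv}{dt}(t)$. A Bernstein function $v$ is called standard if $v(0+)=0$ and $\nabla v(0+)=1$. A Bernstein function $v$ is called bounded if $\lim_{t\to\infty}v(t)<\infty$. (The function $v$ of the claim is called the logistic model; its hapax rate is $h(u)=\frac{e^u\,\nabla v(e^u)}{v(e^u)-v(0+)}=\frac{1}{e^{\gamma u}+1}$.) *)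

(* Defs.v *)
(** Stdlib world: classical reals [R] with Coquelicot. *)
From Stdlib Require Import Reals.
From Coquelicot Require Import Coquelicot.

Open Scope R_scope.

(** A function on (0,oo) is represented by a total function [R -> R]; every
    predicate below depends only on its values on (0,oo), since derivatives at
    [t > 0] and the limits at [0+] and [+oo] are local. *)

Definition smooth_pos (v : R -> R) : Prop :=
  forall (n : nat) (t : R), 0 < t -> ex_derive_n v n t.

Definition is_bernstein (v : R -> R) : Prop :=
  smooth_pos v /\
  (forall t : R, 0 < t -> 0 <= v t) /\
  (forall (k : nat) (t : R), (1 <= k)%nat -> 0 < t ->
     0 <= (-1) ^ (k + 1) * Derive_n v k t).

(** [v(0+) = 0] and [v'(0+) = 1], existence of both limits included. *)
Definition is_standard (v : R -> R) : Prop :=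
  filterlim v (at_right 0) (locally 0) /\
  filterlim (Derive v) (at_right 0) (locally 1).

(** The limit at [+oo] exists and is a finite real; for a Bernstein function,
    which is nondecreasing, it always exists in [0,+oo]. *)
Definition is_bounded (v : R -> R) : Prop :=
  exists l : R, is_lim v p_infty (Finite l).

(** [Rpower x y] is [exp (y * ln x)], the usual power for [x > 0]; here both
    bases are positive when [t > 0]. *)
Definition logistic_model (gamma t : R) : R :=
  t / Rpower (Rpower t gamma + 1) (1 / gamma).

(* Main.v *)
(** The derivative of the logistic model is [(1 + t^gamma)^(-1/gamma - 1)].
    For [gamma <= 1], the convex cone generated by the functions
    [t^p (1 + t^gamma)^q] with [p, q <= 0] consists of nonnegative functions
    and is stable under [f |-> - f'], because
    [- f' = - p t^(p-1) (1 + t^gamma)^q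
            - q gamma t^(p+gamma-1) (1 + t^gamma)^(q-1)].
    So every element of the cone is completely monotone. *)
Require Import Defs.
From Stdlib Require Import Reals Lra Lia.
From Coquelicot Require Import Coquelicot.

Open Scope R_scope.

Lemma Rpower_pos (x y : R) : 0 < Rpower x y.
Proof. apply exp_pos. Qed.

Lemma is_derive_Rpower (y x : R) :
  0 < x -> is_derive (fun t => Rpower t y) x (y * Rpower x (y - 1)).
Proof.
  intros Hx. apply is_derive_Reals. now apply derivable_pt_lim_power.
Qed.

Lemma is_derive_Rpower_1p (a q t : R) :
  0 < t ->
  is_derive (fun t => Rpower (Rpower t a + 1) q) t
    (q * a * Rpower t (a - 1) * Rpower (Rpower t a + 1) (q - 1)).
Proof.
  intros Ht. pose proof (Rpower_pos t a).
  replace (q * a * Rpower t (a - 1) * Rpower (Rpower t a + 1) (q - 1))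
    with (scal (a * Rpower t (a - 1)) (q * Rpower (Rpower t a + 1) (q - 1)))
    by (unfold scal; simpl; unfold mult; simpl; ring).
  apply (is_derive_comp (fun s => Rpower s q) (fun t => Rpower t a + 1)).
  - apply is_derive_Rpower. lra.
  - replace (a * Rpower t (a - 1)) with (plus (a * Rpower t (a - 1)) zero)
      by (unfold plus, zero; simpl; ring).
    apply (is_derive_plus (fun t => Rpower t a) (fun _ => 1)).
    + now apply is_derive_Rpower.
    + apply (is_derive_const (K := R_AbsRing) (V := R_NormedModule)).
Qed.

Lemma locally_pos (t : R) : 0 < t -> locally t (fun s => 0 < s).
Proof. intros Ht. now apply (open_gt 0). Qed.

(** The coefficient [c] is built into the generators, so sums suffice to form all nonnegative
    combinations. *)
Inductive cone (a : R) : (R -> R) -> Prop :=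
| cone_gen (c p q : R) : 0 <= c -> p <= 0 -> q <= 0 ->
    cone a (fun t => c * (Rpower t p * Rpower (Rpower t a + 1) q))
| cone_plus (f g : R -> R) : cone a f -> cone a g ->
    cone a (fun t => f t + g t).

Lemma cone_nonneg (a : R) (f : R -> R) (t : R) : cone a f -> 0 <= f t.
Proof.
  intros Hf. induction Hf as [c p q Hc _ _ | f g _ IHf _ IHg].
  - pose proof (Rpower_pos t p). pose proof (Rpower_pos (Rpower t a + 1) q).
    apply Rmult_le_pos; [lra | nra].
  - lra.
Qed.

Lemma cone_derive (a : R) (f : R -> R) :
  0 <= a <= 1 -> cone a f ->
  exists g, cone a g /\ forall t, 0 < t -> is_derive f t (- g t).
Proof.
  intros Ha Hf.
  induction Hf as [c p q Hc Hp Hq | f1 f2 _ [g1 [C1 D1]] _ [g2 [C2 D2]]].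
  - eexists; split.
    + apply (cone_plus a).
      * apply (cone_gen a (c * - p) (p - 1) q); nra.
      (* Here [a <= 1] is essential: it keeps the new exponent [p + (a - 1)] of [t] nonpositive. *)
      * apply (cone_gen a (c * (- q * a)) (p + (a - 1)) (q - 1)); try lra.
        apply Rmult_le_pos; nra.
    + intros t Ht. cbv beta.
      rewrite Rpower_plus.
      match goal with |- is_derive _ _ ?l => replace l with
        (c * (p * Rpower t (p - 1) * Rpower (Rpower t a + 1) q +
          Rpower t p *
          (q * a * Rpower t (a - 1) * Rpower (Rpower t a + 1) (q - 1))))
        by ring end.
      apply is_derive_scal.
      apply (is_derive_mult (fun t => Rpower t p)
               (fun t => Rpower (Rpower t a + 1) q)).
      * now apply is_derive_Rpower.
      * now apply is_derive_Rpower_1p.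
      * intros; apply Rmult_comm.
  - exists (fun t => g1 t + g2 t). split; [now apply cone_plus |].
    intros t Ht.
    replace (- (g1 t + g2 t)) with (plus (- g1 t) (- g2 t))
      by (unfold plus; simpl; ring).
    apply (is_derive_plus f1 f2); auto.
Qed.

(** The first derivative [w] lies in the cone with sign +1, and each further differentiation yields
    one factor -1 and another element of the cone. *)
Lemma cone_primitive_derive_n (a : R) (v w : R -> R) :
  0 <= a <= 1 -> cone a w -> (forall t, 0 < t -> is_derive v t (w t)) ->
  forall n, exists g, cone a g /\
    forall t, 0 < t -> is_derive_n v (S n) t ((-1) ^ n * g t).
Proof.
  intros Ha Hw Hv n. induction n as [| n [g [Cg Dg]]].
  - exists w. split; [exact Hw |]. intros t Ht.
    replace ((-1) ^ 0 * w t) with (w t) by (simpl; ring). now apply Hv.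
  - destruct (cone_derive a g Ha Cg) as [h [Ch Dh]].
    exists h. split; [exact Ch |]. intros t Ht.
    (* The formula for the previous derivative is known on the positive half-line only, so it is
       substituted in a neighbourhood of [t]. *)
    apply (is_derive_ext_loc (fun s => (-1) ^ n * g s)).
    + apply (filter_imp (fun s => 0 < s)); [| now apply locally_pos].
      intros s Hs. symmetry. apply is_derive_n_unique. now apply Dg.
    + replace ((-1) ^ S n * h t) with ((-1) ^ n * - h t) by (simpl; ring).
      apply is_derive_scal. now apply Dh.
Qed.

Lemma cone_primitive_bernstein (a : R) (v w : R -> R) :
  0 <= a <= 1 -> cone a w -> (forall t, 0 < t -> is_derive v t (w t)) ->
  (forall t, 0 < t -> 0 <= v t) -> is_bernstein v.
Proof.
  intros Ha Hw Hv Hpos.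
  pose proof (cone_primitive_derive_n a v w Ha Hw Hv) as H.
  split; [| split; [exact Hpos |]].
  - intros [| n] t Ht; [exact I |].
    destruct (H n) as [g [_ Dg]]. eexists. now apply Dg.
  - intros [| n] t Hn Ht; [lia |].
    destruct (H n) as [g [Cg Dg]].
    rewrite (is_derive_n_unique _ _ _ _ (Dg t Ht)), <- Rmult_assoc, <- pow_add.
    (* The sign in the Bernstein condition and the sign of the derivative combine to an even power
       of -1. *)
    replace (S n + 1 + n)%nat with (2 * S n)%nat by lia.
    rewrite pow_1_even, Rmult_1_l. now apply (cone_nonneg a).
Qed.

Lemma logistic_model_eq (gamma t : R) :
  logistic_model gamma t = t * Rpower (Rpower t gamma + 1) (- / gamma).
Proof.
  unfold logistic_model, Rdiv. now rewrite Rmult_1_l, <- Rpower_Ropp.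
Qed.

(** Factoring [t^gamma] out of the base produces [(t^gamma)^(-1/gamma) = 1/t], which cancels the
    numerator. This form shows the limit at infinity, since [t^(-gamma)] tends to 0 for positive
    [gamma]. *)
Lemma logistic_model_eq_inv (gamma t : R) :
  gamma <> 0 -> 0 < t ->
  logistic_model gamma t = Rpower (Rpower t (- gamma) + 1) (- / gamma).
Proof.
  intros Hg Ht. rewrite logistic_model_eq.
  pose proof (Rpower_pos t gamma) as H1.
  pose proof (Rpower_pos t (- gamma)) as H2.
  replace (Rpower t gamma + 1)
    with (Rpower t gamma * (Rpower t (- gamma) + 1)).
  - rewrite <- Rpower_mult_distr by lra.
    rewrite Rpower_mult.
    replace (gamma * - / gamma) with (- (1)) by now field.
    rewrite Rpower_Ropp, Rpower_1 by assumption. field. lra.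
  - rewrite Rmult_plus_distr_l, <- Rpower_plus, Rplus_opp_r, Rpower_O by lra.
    ring.
Qed.

(** The product rule gives [(t^gamma + 1)^(-1/gamma) - t^gamma (t^gamma + 1)^(-1/gamma - 1)]; taking
    out the lower power leaves the factor [(t^gamma + 1) - t^gamma = 1]. *)
Lemma is_derive_logistic_model (gamma t : R) :
  gamma <> 0 -> 0 < t ->
  is_derive (logistic_model gamma) t
    (Rpower (Rpower t gamma + 1) (- / gamma - 1)).
Proof.
  intros Hg Ht. pose proof (Rpower_pos t gamma) as H1.
  apply (is_derive_ext
           (fun s => s * Rpower (Rpower s gamma + 1) (- / gamma))).
  { intros s. symmetry. apply logistic_model_eq. }
  replace (Rpower (Rpower t gamma + 1) (- / gamma - 1)) with
    (1 * Rpower (Rpower t gamma + 1) (- / gamma) +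
     t * (- / gamma * gamma * Rpower t (gamma - 1) *
          Rpower (Rpower t gamma + 1) (- / gamma - 1))).
  - apply (is_derive_mult (fun s : R => s)
             (fun s => Rpower (Rpower s gamma + 1) (- / gamma))).
    + apply (is_derive_id (K := R_AbsRing)).
    + now apply is_derive_Rpower_1p.
    + intros; apply Rmult_comm.
  - replace (Rpower (Rpower t gamma + 1) (- / gamma)) with
      (Rpower (Rpower t gamma + 1) (- / gamma - 1) * (Rpower t gamma + 1)).
    + replace (Rpower t gamma) with (t * Rpower t (gamma - 1)) at 2.
      * field. exact Hg.
      * rewrite <- (Rpower_1 t Ht) at 1. rewrite <- Rpower_plus.
        f_equal. ring.
    + rewrite <- (Rpower_1 (Rpower t gamma + 1)) at 2 by lra.
      rewrite <- Rpower_plus. f_equal. ring.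
Qed.

Lemma filterlim_Rpower_0 (a : R) :
  0 < a -> filterlim (fun t => Rpower t a) (at_right 0) (locally 0).
Proof.
  intros Ha. unfold Rpower.
  apply (filterlim_comp _ _ _ (fun t => a * ln t) exp _ (Rbar_locally m_infty)).
  - apply (filterlim_comp _ _ _ ln (Rmult a) _ (Rbar_locally m_infty)).
    + apply is_lim_ln_0.
    + pose proof (filterlim_Rbar_mult_l a m_infty) as H.
      rewrite (is_Rbar_mult_unique a m_infty m_infty) in H; [exact H |].
      now apply is_Rbar_mult_sym, is_Rbar_mult_m_infty_pos.
  - apply is_lim_exp_m.
Qed.

Lemma filterlim_Rpower_neg_p_infty (a : R) :
  0 < a -> filterlim (fun t => Rpower t (- a)) (Rbar_locally p_infty) (locally 0).
Proof.
  intros Ha. unfold Rpower.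
  apply (filterlim_comp _ _ _ (fun t => - a * ln t) exp _ (Rbar_locally m_infty)).
  - apply (filterlim_comp _ _ _ ln (Rmult (- a)) _ (Rbar_locally p_infty)).
    + apply is_lim_ln_p.
    + pose proof (filterlim_Rbar_mult_l (- a) p_infty) as H.
      rewrite (is_Rbar_mult_unique (- a) p_infty m_infty) in H; [exact H |].
      apply is_Rbar_mult_sym, is_Rbar_mult_p_infty_neg; simpl; lra.
  - apply is_lim_exp_m.
Qed.

(** Continuity of [s |-> (s + 1)^q] at 0, stated for an arbitrary filter because it serves both at
    [0+] and at infinity. *)
Lemma filterlim_Rpower_1p (F : (R -> Prop) -> Prop) (f : R -> R) (q : R) :
  filterlim f F (locally 0) ->
  filterlim (fun t => Rpower (f t + 1) q) F (locally 1).
Proof.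
  intros Hf.
  apply (filterlim_comp _ _ _ f (fun s => Rpower (s + 1) q) _ (locally 0));
    [exact Hf |].
  assert (Hc : continuous (fun s => Rpower (s + 1) q) 0).
  { apply (ex_derive_continuous (fun s => Rpower (s + 1) q) 0).
    unfold Rpower. auto_derive. lra. }
  assert (H1 : Rpower (0 + 1) q = 1)
    by (unfold Rpower; rewrite Rplus_0_l, ln_1, Rmult_0_r; apply exp_0).
  unfold continuous in Hc. now rewrite H1 in Hc.
Qed.

Lemma at_right_0_pos : at_right 0 (fun t => 0 < t).
Proof. now exists (mkposreal 1 Rlt_0_1). Qed.

Theorem proposition18 (gamma : R) (hgamma : 0 < gamma <= 1) :
  is_bernstein (logistic_model gamma) /\
  is_bounded (logistic_model gamma) /\
  is_standard (logistic_model gamma).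
Proof.
  assert (Hg : gamma <> 0) by lra.
  assert (Hinv : 0 < / gamma) by (apply Rinv_0_lt_compat; lra).
  split; [| split; [| split]].
  (* The derivative is written as a single generator of the cone, with [c = 1], [p = 0] and
     [q = -1/gamma - 1]. *)
  - apply (cone_primitive_bernstein gamma _
      (fun t => 1 * (Rpower t 0 * Rpower (Rpower t gamma + 1) (- / gamma - 1)))).
    + lra.
    + apply cone_gen; lra.
    + intros t Ht. rewrite Rpower_O, !Rmult_1_l by exact Ht.
      now apply is_derive_logistic_model.
    + intros t Ht. rewrite logistic_model_eq.
      pose proof (Rpower_pos (Rpower t gamma + 1) (- / gamma)). nra.
  - exists 1.
    apply (filterlim_ext_loc
      (fun t => Rpower (Rpower t (- gamma) + 1) (- / gamma))).
    + exists 0. intros t Ht. symmetry. now apply logistic_model_eq_inv.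
    + apply (filterlim_Rpower_1p (Rbar_locally p_infty)).
      now apply filterlim_Rpower_neg_p_infty.
  - apply (filterlim_ext
      (fun t => t * Rpower (Rpower t gamma + 1) (- / gamma))).
    { intros t. symmetry. apply logistic_model_eq. }
    (* The limit is split as a product: the factor [t] tends to 0 and the power of [t^gamma + 1]
       tends to 1. *)
    replace 0 with (0 * 1) at 2 by ring.
    apply (filterlim_comp_2 (G := locally 0) (H := locally 1)
             (fun t => t)
             (fun t => Rpower (Rpower t gamma + 1) (- / gamma)) Rmult).
    + apply filter_le_within.
    + apply (filterlim_Rpower_1p (at_right 0)). now apply filterlim_Rpower_0.
    + apply (filterlim_mult (K := R_AbsRing) 0 1).
  (* The closed form of the derivative holds for [t > 0], which is eventually true along
     [at_right 0]. *)
  - apply (filterlim_ext_loc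
      (fun t => Rpower (Rpower t gamma + 1) (- / gamma - 1))).
    + apply (filter_imp (fun t => 0 < t)); [| exact at_right_0_pos].
      intros t Ht. symmetry. apply is_derive_unique.
      now apply is_derive_logistic_model.
    + apply (filterlim_Rpower_1p (at_right 0)). now apply filterlim_Rpower_0.
Qed.
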